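(* For every oriented link $L$, $$P_1(L)=P_{\mathrm H}(L;\omega,\mathrm i),$$ where $\omega=e^{2\pi\mathrm i/3}$.
   Context: Let $V=\mathbb C^3$ with orthonormal basis $e_j$, $j\in\mathbb F_3$, $Xe_j=e_{j+1}$, $Ze_j=\omega^je_j$, and $U=Z\otimes X$ on $V\otimes V$. Define the unitary Yang--Baxter operator $$R_1=(Z\otimes Z)\cdot\frac1{\sqrt3}\bigl(I+\omega^2(U+U^2)\bigr)\cdot(Z\otimes Z)^{-1}.$$ For the braid group $\mathcal B_n$ with Artin generators $\sigma_i$, let $\rho_{R_1,n}(\sigma_i)=I^{\otimes(i-1)}\otimes R_1\otimes I^{\otimes(n-i-1)}$ on $V^{\otimes n}$. For an oriented link $L=\widehat\xi$ that is the closure of $\xi\in\mathcal B_n$, put $T_1(L)=3^{-n/2}\mathrm{Tr}(\rho_{R_1,n}(\xi))$ and $P_1(L)=3^{-1/2}T_1(L)$; these are well-defined oriented link invariants (obtained from the scalar Turaev enhancement of $R_1$ with ordinary trace and parameters $\alpha=1$, $\beta=\sqrt3$), and $P_1(\bigcirc)=1$. The generator $\sigma_i$ corresponds to a positive crossing. $P_{\mathrm H}(L;a,z)$ is the normalized HOMFLYPT polynomial determined by $aP_{\mathrm H}(L_+;a,z)-a^{-1}P_{\mathrm H}(L_-;a,z)=zP_{\mathrm H}(L_0;a,z)$ and $P_{\mathrm H}(\bigcirc;a,z)=1$, where $L_+,L_-,L_0$ differ only by a positive crossing, a negative crossing, and the oriented smoothing. *)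

(* Defs.v *)
From HB Require Import structures.
From Stdlib Require Import Relation_Operators.
From mathcomp Require Import all_boot all_order all_algebra finmap.
From mathcomp Require Import reals trigo.
From mathcomp Require Import complex mxtens zify.
Set Implicit Arguments.
Unset Strict Implicit.
Unset Printing Implicit Defensive.
Import Order.TTheory GRing.Theory Num.Theory.

Local Open Scope ring_scope.

(** An oriented link diagram in general position with respect to a height function is
    read from bottom to top as a list of slices, each containing one elementary
    tile.  Level sets are recorded as lists of directions of the strands met
    from left to right ([true]: upwards, [false]: downwards). *)

Inductive tile :=
  | Cup of bool     (* local minimum; the boolean directs its left end *)
  | Cap             (* local maximum *)
  | Cross of bool.  (* [Cross true]: the strand from bottom left to top right
                       is the over-strand; [Cross false]: the under-strand *)

(* A tile together with the number of strands to its left. *)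
Definition slice := (nat * tile)%type.

Definition tile_in (t : tile) : nat := if t is Cup _ then 0%N else 2%N.
Definition tile_out (t : tile) : nat := if t is Cap then 0%N else 2%N.

Definition slice_act (x : slice) (s : seq bool) : option (seq bool) :=
  let: (i, t) := x in
  match t with
  | Cup d =>
      if (i <= size s)%N then Some (take i s ++ d :: ~~ d :: drop i s) else None
  | Cap =>
      if drop i s is d :: e :: s' then
        if d != e then Some (take i s ++ s') else None
      else None
  | Cross _ =>
      if drop i s is d :: e :: s' then Some (take i s ++ e :: d :: s') else None
  end.

Fixpoint slices_act (D : seq slice) (s : seq bool) : option (seq bool) :=
  if D is x :: D' then obind (slices_act D') (slice_act x s) else Some s.

(* The empty diagram (the empty link) is allowed; neither isotopy nor the skein
   relation ever relates it to a nonempty diagram. *)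
Definition link_diagram := {D : seq slice | slices_act D [::] == Some [::]}.

(** Isotopy: planar isotopies of sliced diagrams ([mv_far] to [mv_cross_cap])
    and the Reidemeister moves ([mv_R1_cup] to [mv_R3]).  Orientations are not
    constrained here, since both sides of a move have to be legal. *)
Inductive local_move : seq slice -> seq slice -> Prop :=
  | mv_far i t j u : (i + tile_in t <= j)%N ->
      local_move [:: (j, u); (i, t)]
                 [:: (i, t); ((j - tile_in t) + tile_out t, u)%N]
  | mv_zigzag_l i d : local_move [:: (i, Cup d); (i.+1, Cap)] [::]
  | mv_zigzag_r i d : local_move [:: (i.+1, Cup d); (i, Cap)] [::]
  | mv_cup_cross i d o :
      local_move [:: (i, Cup d); (i.+1, Cross o)]
                 [:: (i.+1, Cup d); (i, Cross (~~ o))]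
  | mv_cross_cap i o :
      local_move [:: (i, Cross o); (i.+1, Cap)]
                 [:: (i.+1, Cross (~~ o)); (i, Cap)]
  | mv_R1_cup i d o : local_move [:: (i, Cup d); (i, Cross o)] [:: (i, Cup (~~ d))]
  | mv_R1_cap i o : local_move [:: (i, Cross o); (i, Cap)] [:: (i, Cap)]
  | mv_R2 i o : local_move [:: (i, Cross o); (i, Cross (~~ o))] [::]
  (* a, b, c: does strand 1 pass over 2, 1 over 3, 2 over 3?  The condition
     excludes the two cyclic patterns. *)
  | mv_R3 i a b c : (a == c ==> (b == a)) ->
      local_move [:: (i, Cross a); (i.+1, Cross b); (i, Cross c)]
                 [:: (i.+1, Cross c); (i, Cross b); (i.+1, Cross a)].

Definition diagram_move (D D' : link_diagram) : Prop :=
  exists A m m' B : seq slice,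
    [/\ local_move m m', val D = A ++ m ++ B & val D' = A ++ m' ++ B].

(* By Reidemeister's theorem in its sliced form, two diagrams are isotopic iff
   they represent the same oriented link. *)
Definition isotopic : link_diagram -> link_diagram -> Prop :=
  clos_refl_sym_trans link_diagram diagram_move.

(** Skein triples.  A crossing is positive when turning its over-strand
    counterclockwise by less than a half-turn onto its under-strand matches
    their directions; so [Cross o] between two parallel strands has sign [o],
    and reversing one of the strands reverses the sign. *)
Definition skein_triple (Dp Dm D0 : link_diagram) : Prop :=
  exists (A B : seq slice) (s : seq bool) (i : nat),
    let d := nth true s i in
    let e := nth true s i.+1 in
    [/\ slices_act A [::] = Some s, (i.+1 < size s)%N,
        val Dp = A ++ (i, Cross (d == e)) :: B,
        val Dm = A ++ (i, Cross (d != e)) :: B &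
        val D0 = A ++ (if d == e then [::] else [:: (i, Cap); (i, Cup e)]) ++ B].

Definition unknot : link_diagram.
Proof. by exists [:: (0%N, Cup true); (0%N, Cap)]. Defined.

(* Integer Laurent polynomials in a and z: the coefficient of a^m z^n is the
   value at (m, n). *)
Definition laurent := {fsfun int * int -> int with 0}.

Definition laurent_eval (F : fieldType) (p : laurent) (a z : F) : F :=
  \sum_(m <- finsupp p) (p m)%:~R * a ^ m.1 * z ^ m.2.

(* An identity of Laurent polynomials is stated as an identity of functions of
   nonzero complex a and z. *)
Definition is_HOMFLYPT (R : realType) (P : link_diagram -> laurent) : Prop :=
  [/\ forall D D', isotopic D D' -> P D = P D',
      forall a z : R[i], a != 0 -> z != 0 -> laurent_eval (P unknot) a z = 1 &
      forall Dp Dm D0, skein_triple Dp Dm D0 ->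
      forall a z : R[i], a != 0 -> z != 0 ->
        a * laurent_eval (P Dp) a z - a^-1 * laurent_eval (P Dm) a z
          = z * laurent_eval (P D0) a z].

(* Words in the Artin generators of the n-strand braid group: [(i, true)] is
   the generator exchanging strands i and i.+1 (counted from 0) and [(i, false)]
   is its inverse; words are read from bottom to top in diagrams, and [rho] below
   sends concatenation to the matrix product. *)
Definition braid_word (n : nat) := seq ('I_n.-1 * bool).

Definition closure_slices n (xi : braid_word n) : seq slice :=
  [seq (k, Cup true) | k <- iota 0 n]
    ++ [seq (val g.1, Cross g.2) | g <- xi]
    ++ [seq (k, Cap) | k <- rev (iota 0 n)].

Lemma slices_act_cat A B s :
  slices_act (A ++ B) s = obind (slices_act B) (slices_act A s).
Proof. by elim: A s => //= x A IH s; case: (slice_act x s) => //=. Qed.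

Lemma slices_act_cups n :
  slices_act [seq (k, Cup true) | k <- iota 0 n] [::]
    = Some (nseq n true ++ nseq n false).
Proof.
elim: n => // n IH; rewrite -addn1 iotaD map_cat slices_act_cat IH /= add0n.
rewrite size_cat !size_nseq leq_addr take_size_cat ?size_nseq //.
rewrite drop_size_cat ?size_nseq // nseqD -catA [in RHS]addnC nseqD.
by [].
Qed.

Lemma slices_act_crossings n (xi : braid_word n) :
  slices_act [seq (val g.1, Cross g.2) | g <- xi] (nseq n true ++ nseq n false)
    = Some (nseq n true ++ nseq n false).
Proof.
elim: xi => // -[i b] xi IH; have := ltn_ord i.
rewrite [map _ _]/= [slices_act _ _]/= -/(slice_act (val i, Cross b) _).
suff slice_actE k m : (k < m.-1)%N ->
    slice_act (k, Cross b) (nseq m true ++ nseq m false)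
      = Some (nseq m true ++ nseq m false).
  by move=> /slice_actE; rewrite /= => ->.
move=> lt_k_m; rewrite /slice_act -[X in nseq X true](@subnKC k m); last by lia.
have -> : (m - k = 2 + (m - k - 2))%N by lia.
by rewrite !nseqD -!catA drop_size_cat ?take_size_cat ?size_nseq.
Qed.

Lemma slices_act_caps n :
  slices_act [seq (k, Cap) | k <- rev (iota 0 n)] (nseq n true ++ nseq n false)
    = Some [::].
Proof.
elim: n => // n IH; rewrite -{1}addn1 iotaD rev_cat [nseq n.+1 false]/=.
have -> : nseq n.+1 true = nseq n true ++ [:: true] by rewrite -addn1 nseqD.
rewrite -catA /=.
by rewrite drop_size_cat ?take_size_cat ?size_nseq.
Qed.

Lemma closure_subproof n (xi : braid_word n) :
  slices_act (closure_slices xi) [::] == Some [::].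
Proof.
rewrite /closure_slices slices_act_cat slices_act_cups /= slices_act_cat.
by rewrite slices_act_crossings /= slices_act_caps.
Qed.

(* The strands of the braid are directed upwards and close up on the right. *)
Definition braid_closure n (xi : braid_word n) : link_diagram :=
  exist _ (closure_slices xi) (closure_subproof xi).

Lemma site_dim n (i : 'I_n.-1) : (3 ^ i * (3 * 3) * 3 ^ (n - i - 2) = 3 ^ n)%N.
Proof.
have lt_i_n := ltn_ord i; rewrite -[(3 * 3)%N]/(3 ^ 2)%N -!expnD.
by congr expn; lia.
Qed.

Section P1.
Variable R : realType.
Local Notation C := R[i].
Local Open Scope complex_scope.

Definition omega : C := cos (2 * pi / 3) +i* sin (2 * pi / 3).

(* Matrices act on columns. *)
Definition shift_X : 'M[C]_3 := \matrix_(i, j) (i == j + 1)%:R.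
Definition clock_Z : 'M[C]_3 := \matrix_(i, j) (omega ^+ j *+ (i == j)).

Definition op_U : 'M[C]_(3 * 3) := clock_Z *t shift_X.

Definition R1 : 'M[C]_(3 * 3) :=
  (clock_Z *t clock_Z)
    *m ((sqrtC 3)^-1 *: (1%:M + omega ^+ 2 *: (op_U + op_U *m op_U)))
    *m invmx (clock_Z *t clock_Z).

Definition rho_gen n (i : 'I_n.-1) : 'M[C]_(3 ^ n) :=
  castmx (site_dim i, site_dim i)
    ((1%:M : 'M_(3 ^ i)) *t R1 *t (1%:M : 'M_(3 ^ (n - i - 2)))).

Definition rho n (xi : braid_word n) : 'M[C]_(3 ^ n) :=
  \big[mulmx/1%:M]_(g <- xi) (if g.2 then rho_gen g.1 else invmx (rho_gen g.1)).

Definition T1 n (xi : braid_word n) : C := (sqrtC 3) ^- n * \tr (rho xi).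

Definition P1 n (xi : braid_word n) : C := (sqrtC 3)^-1 * T1 xi.

End P1.

(* Main.v *)
(** Both sides, as functions of a braid word, obey the same skein relation, the braid relations and Markov
    stabilization, and this determines them up to their value on the trivial one-strand braid: the skein
    relation reduces to positive words, a quadratic relation and the braid relations then reduce to words with
    at most one letter of top index, and stabilization removes that strand; a strand not met by any letter
    is removed by comparing its two stabilizations through the skein relation.

    For the HOMFLYPT side these are isotopies of closed braid diagrams.  For the matrix side,
    [R1 = (1 + U + omega U^2) / sqrt 3] with [U = Z (x) X] of order three, so only the commutation rules of
    the [U]'s acting on successive pairs of strands matter. *)

Require Import Defs.
From HB Require Import structures.
From mathcomp Require Import all_boot all_order all_algebra finmap.
From mathcomp Require Import reals trigo.
From mathcomp Require Import complex mxtens.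
From mathcomp Require Import zify ring lra.
From Stdlib Require Import Relation_Operators.
Set Implicit Arguments.
Unset Strict Implicit.
Unset Printing Implicit Defensive.
Import Order.TTheory GRing.Theory Num.Theory.

Local Open Scope ring_scope.
Local Open Scope complex_scope.

(** * Functionals on Hecke algebras *)

Section Hecke.
Variables (F : fieldType) (p q : F).

(* The linear extension of [h] factors through the Hecke algebra on the generators of index less than [m],
   with quadratic relation [g^2 = p g + q]. *)
Record hecke_functional (m : nat) (h : seq nat -> F) : Prop := {
  hecke_quad i u v : (i < m)%N -> all (gtn m) (u ++ v) ->
    h (u ++ i :: i :: v) = p * h (u ++ i :: v) + q * h (u ++ v);
  hecke_far i j u v : (i.+1 < j < m)%N -> all (gtn m) (u ++ v) ->
    h (u ++ j :: i :: v) = h (u ++ i :: j :: v);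
  hecke_braid i u v : (i.+1 < m)%N -> all (gtn m) (u ++ v) ->
    h (u ++ i.+1 :: i :: i.+1 :: v) = h (u ++ i :: i.+1 :: i :: v) }.

Lemma hecke_far_seq m h y u v : hecke_functional m.+1 h ->
  all (gtn m.-1) y -> all (gtn m.+1) (u ++ v) ->
  h (u ++ m :: y ++ v) = h (u ++ y ++ m :: v).
Proof.
move=> Hh; elim: y u => //= i y IH u /andP[lt_i lt_y].
rewrite all_cat => /andP[lt_u lt_v].
have sub_y : all (gtn m.+1) y.
  by apply: sub_all lt_y => j /=; lia.
rewrite (hecke_far Hh); first last.
- by rewrite !all_cat lt_u sub_y.
- lia.
rewrite -cat_rcons IH ?cat_rcons // all_cat lt_u /= lt_v andbT; lia.
Qed.

Lemma split_first (T : eqType) (x : T) s : x \in s ->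
  exists u v, s = u ++ x :: v /\ x \notin u.
Proof.
elim: s => //= y s IH; rewrite inE; have [->|ne_xy] := eqVneq x y.
  by exists [::], s.
move=> /= /IH[u [v [-> xNu]]]; exists (y :: u), v; split=> //.
by rewrite inE negb_or ne_xy.
Qed.

Lemma lt_top m (y : seq nat) : all (gtn m.+1) y -> m \notin y -> all (gtn m) y.
Proof.
move=> /allP lt_y mNy; apply/allP => j jy /=.
have /= := lt_y j jy; have : j != m by apply: contraNneq mNy => <-.
lia.
Qed.

(* Two successive top generators enclose a word in the lower ones; by induction that word has at most one
   generator of the next lower index, and then the number of top ones drops. *)
Lemma hecke_functional_eq0 m h : hecke_functional m h ->
  (forall w, all (gtn m) w -> (count_mem m.-1 w <= 1)%N -> h w = 0) ->
  forall w, all (gtn m) w -> h w = 0.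
Proof.
elim: m h => [|m IHm] h Hh h0 w lt_w.
  by apply: h0 => //; case: w lt_w.
(* Inner induction on the number of top letters; the outer one is on the number of generators. *)
have [k] := ubnP (count_mem m w); elim: k => // k IHk in w lt_w * => lt_k.
have [le1|gt1] := leqP (count_mem m w) 1; first exact: h0.
have /split_first[u [w1 [eq_w mNu]]] : m \in w by rewrite -has_pred1 has_count; lia.
move: lt_w lt_k gt1; rewrite eq_w all_cat count_cat /= eqxx.
rewrite (count_memPn mNu) add0n add1n ltnS => /and3P[lt_u lt_m lt_w1] lt_k gt1.
have /split_first[y [v [eq_w1 mNy]]] : m \in w1 by rewrite -has_pred1 has_count.
move: lt_w1 lt_k gt1; rewrite eq_w1 all_cat count_cat /= eqxx.
rewrite (count_memPn mNy) add0n add1n => /and3P[lt_y _ lt_v] lt_k _.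
(* Fixing everything outside the word [y] between the first two top letters gives a functional with
   one generator fewer, to which the outer induction applies. *)
pose h' (x : seq nat) := h (u ++ m :: x ++ m :: v).
have h'E x1 x2 : h' (x1 ++ x2) = h ((rcons u m ++ x1) ++ x2 ++ m :: v).
  by rewrite /h' cat_rcons -!catA.
suff: h' y = 0 by [].
have le_m x : all (gtn m) x -> all (gtn m.+1) x by apply: sub_all => j /=; lia.
have lt_ctx x1 x2 : all (gtn m) (x1 ++ x2) ->
    all (gtn m.+1) ((rcons u m ++ x1) ++ x2 ++ m :: v).
  by move=> /le_m; rewrite !all_cat all_rcons /= lt_u lt_v ltnSn !andbT => /andP[-> ->].
apply: (IHm h'); last exact: lt_top.
  split=> i.
  - move=> x1 x2 lt_i lt_x; rewrite !h'E /= (hecke_quad Hh) //; first lia.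
    exact: lt_ctx.
  - move=> j x1 x2 lt_i lt_x; rewrite !h'E /= (hecke_far Hh) //; first lia.
    exact: lt_ctx.
  - move=> x1 x2 lt_i lt_x; rewrite !h'E /= (hecke_braid Hh) //; first lia.
    exact: lt_ctx.
move=> {y mNy lt_y eq_w1} x lt_x le1.
(* If [m.-1] does not occur, the left top letter commutes past [x] and meets the right one; the
   quadratic relation then leaves one top letter or none of the two. For [m = 0] the bound on [x] is
   just [lt_x], as [m.-1] is again 0. *)
have [x0|] := posnP (count_mem m.-1 x).
  have lt_x' : all (gtn m.-1) x.
    case: (m) lt_x x0 => [|m'] // lt_x x0; apply: lt_top => //=.
    by apply/count_memPn.
  rewrite /h' (hecke_far_seq Hh) //; last first.
    by rewrite all_cat lt_u /= lt_v ltnSn.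
  have lt_uxv : all (gtn m.+1) ((u ++ x) ++ v) by rewrite !all_cat lt_u lt_v le_m.
  have nu : count_mem m (u ++ x) = 0%N.
    rewrite count_cat (count_memPn mNu) add0n; apply/count_memPn/negP => mx.
    by have /allP/(_ _ mx) /= := lt_x; rewrite ltnn.
  rewrite catA (hecke_quad Hh) // !IHk ?mulr0 ?addr0 //.
  - by rewrite count_cat nu add0n ltnW.
  - by move: lt_uxv; rewrite !all_cat /= leqnn.
  - by rewrite count_cat nu /= eqxx add0n add1n.
(* If it occurs once, both top letters are moved next to it, and the braid relation trades the two
   of them for one. After renaming, the top letter is [m.+1] and the one below it is [m]. *)
move=> x_gt0; have [m' def_m] : exists m', m = m'.+1.
  by case: (m) (x) lt_x x_gt0 => [[]|m' *] //; exists m'.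
subst m; rename m' into m; move: x_gt0.
rewrite -has_count has_pred1 /= => mx.
have [x1 [x2 [eq_x mNx1]]] := split_first mx.
move: lt_x le1; rewrite eq_x all_cat count_cat /= eqxx.
rewrite (count_memPn mNx1) add0n => /and3P[lt_x1 _ lt_x2].
rewrite -[X in (_ <= X)%N]addn0 leq_add2l leqn0 => /eqP x2_0.
have mNx2 : m \notin x2 by apply/count_memPn.
have l1 := lt_top lt_x1 mNx1; have l2 := lt_top lt_x2 mNx2.
have lt_uv : all (gtn m.+2) ((u ++ x1) ++ x2 ++ v).
  by rewrite !all_cat lt_u lt_v !le_m.
rewrite /h' -!catA cat_cons (@hecke_far_seq _ _ x1 _ _ Hh) //; last first.
  move: lt_uv; clear; rewrite !all_cat /= ?all_cat /=; lia.
have -> : u ++ x1 ++ m.+1 :: m :: x2 ++ m.+1 :: v =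
    (u ++ x1 ++ [:: m.+1; m]) ++ x2 ++ m.+1 :: v by rewrite -!catA.
rewrite -(hecke_far_seq Hh) //=; last first.
  move: lt_uv; clear; rewrite !all_cat /= ?all_cat /=; lia.
rewrite -!catA /= catA (hecke_braid Hh) //.
have neq : (m == m.+1) = false by rewrite ltn_eqF.
have z x' : all (gtn m.+1) x' -> count_mem m.+1 x' = 0%N.
  move=> lt'; apply/count_memPn/negP => mx'.
  by have /allP/(_ _ mx') /= := lt'; rewrite ltnn.
apply: IHk.
  move: lt_uv; clear; rewrite !all_cat /= ?all_cat /=; lia.
rewrite !count_cat /= eqxx neq !count_cat (count_memPn mNu) (z _ lt_x1) (z _ lt_x2) /=.
move: lt_k; clear; lia.
Qed.
End Hecke.

(** * Skein functionals on braid words *)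

Definition letters_lt (n : nat) (w : seq (nat * bool)) : bool := all (fun g => g.1.+1 < n)%N w.

Section SkeinFunctional.
Variables (F : fieldType) (a z : F).

(* [d n w] is the value on the closure of the n-strand braid word [w]. The letter [(i, b)] uses strands [i] and
   [i.+1], so the stabilizing letter on n + 2 strands is [(n, b)]. *)
Record skein_functional (d : nat -> seq (nat * bool) -> F) : Prop := {
  skein_rel n i u v : (i.+1 < n)%N -> letters_lt n (u ++ v) ->
    a * d n (u ++ (i, true) :: v) - a^-1 * d n (u ++ (i, false) :: v)
      = z * d n (u ++ v);
  skein_cancel n i u v : (i.+1 < n)%N -> letters_lt n (u ++ v) ->
    d n (u ++ (i, true) :: (i, false) :: v) = d n (u ++ v);
  skein_far n i j u v : (i.+1 < j)%N -> (j.+1 < n)%N -> letters_lt n (u ++ v) ->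
    d n (u ++ (j, true) :: (i, true) :: v) = d n (u ++ (i, true) :: (j, true) :: v);
  skein_braid n i u v : (i.+2 < n)%N -> letters_lt n (u ++ v) ->
    d n (u ++ (i.+1, true) :: (i, true) :: (i.+1, true) :: v)
      = d n (u ++ (i, true) :: (i.+1, true) :: (i, true) :: v);
  skein_markov n b u v : letters_lt n.+1 (u ++ v) ->
    d n.+2 (u ++ (n, b) :: v) = d n.+1 (u ++ v) }.

(** All the relations are linear, so uniqueness of a skein functional reduces to a vanishing
    statement about a difference. *)
Lemma skein_functionalB d e : skein_functional d -> skein_functional e ->
  skein_functional (fun n w => d n w - e n w).
Proof.
move=> Hd He; split=> [n i u v lt_i lt_uv|*|*|*|*].
- rewrite [RHS]mulrBr -(skein_rel Hd lt_i) // -(skein_rel He lt_i) //; ring.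
- by rewrite (skein_cancel Hd) // (skein_cancel He).
- by rewrite (skein_far Hd) // (skein_far He).
- by rewrite (skein_braid Hd) // (skein_braid He).
- by rewrite (skein_markov Hd) // (skein_markov He).
Qed.

Hypotheses (a_neq0 : a != 0) (z_neq0 : z != 0).

Let pos (w : seq nat) := [seq (i, true) | i <- w].

Lemma letters_lt_pos n w : all (gtn n) w -> letters_lt n.+1 (pos w).
Proof. by rewrite /letters_lt all_map; apply: sub_all => j /=; lia. Qed.

(** Letters are made positive from left to right, [p] being the part already treated. At a negative
    letter, the values with the letter made positive and with it deleted both vanish, and the skein
    relation forces the third value to vanish. *)
Lemma skein_functional_pos d n : skein_functional d ->
  (forall w, all (gtn n) w -> d n.+1 (pos w) = 0) ->
  forall w, letters_lt n.+1 w -> d n.+1 w = 0.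
Proof.
move=> Hd d0 w; rewrite -[w]/(pos [::] ++ w).
have : all (gtn n) [::] by [].
elim: w [::] => [|[i b] w IH] p lt_p /=; first by rewrite cats0 d0.
rewrite /letters_lt all_cat /= => /and3P[_ lt_i lt_w].
have lt_pi : all (gtn n) (rcons p i) by rewrite all_rcons lt_p andbT /=; lia.
have lt_pw : letters_lt n.+1 (pos p ++ w).
  by rewrite /letters_lt all_cat lt_w -/(letters_lt _ _) letters_lt_pos.
have d1 : d n.+1 (pos p ++ (i, true) :: w) = 0.
  have := IH _ lt_pi; rewrite /pos map_rcons cat_rcons; apply.
  move: lt_pw; rewrite /letters_lt !all_cat /= => /andP[-> ->].
  by rewrite lt_i.
case: b => //; have := skein_rel Hd lt_i lt_pw.
rewrite d1 (IH p) // !mulr0 sub0r => /eqP.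
by rewrite oppr_eq0 mulf_eq0 invr_eq0 (negbTE a_neq0) => /eqP.
Qed.

(** The skein relation taken just after a positive letter [g] reads [a g^2 - a^-1 = z g], which is
    the quadratic relation after division by [a]. *)
Lemma skein_functional_hecke d n : skein_functional d ->
  hecke_functional (a^-1 * z) (a^-1 ^+ 2) n (fun w => d n.+1 (pos w)).
Proof.
move=> Hd; split=> [i u v lt_i|i j u v lt_ij|i u v lt_i];
  move=> /letters_lt_pos; rewrite /pos !map_cat /= => lt_uv.
- have lt_uiv : letters_lt n.+1 (pos u ++ (i, true) :: pos v).
    move: lt_uv; rewrite /letters_lt !all_cat /= => /andP[-> ->].
    by rewrite ltnS lt_i.
  have lt_uiv' : letters_lt n.+1 ((pos u ++ [:: (i, true)]) ++ pos v) by rewrite -catA.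
  have := @skein_rel _ Hd n.+1 i _ _ lt_i lt_uiv'; rewrite -!catA /= (skein_cancel Hd) //.
  move=> /(congr1 ( *%R a^-1)); rewrite mulrBr mulKf // => /eqP.
  rewrite subr_eq => /eqP ->; ring.
- by rewrite (skein_far Hd) //; lia.
- by rewrite (skein_braid Hd).
Qed.

Lemma skein_functional_eq0 d : skein_functional d -> d 1%N [::] = 0 ->
  forall n w, letters_lt n.+1 w -> d n.+1 w = 0.
Proof.
move=> Hd d0; elim=> [|n IHn] w; first by case: w.
apply: skein_functional_pos => // {}w.
apply: (hecke_functional_eq0 (skein_functional_hecke n.+1 Hd)) => {}w lt_w le1.
(* No letter meets the last strand: inserting a letter of index [n] with either sign gives two
   stabilizations, whose values vanish by induction, so the skein relation leaves [z] times the
   wanted value equal to 0. *)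
have [w0|] := posnP (count_mem n w).
  have lt_w' : letters_lt n.+1 (pos w ++ [::]).
    by rewrite cats0; apply/letters_lt_pos/lt_top => //; apply/count_memPn.
  have lt_w2 : letters_lt n.+2 (pos w ++ [::]).
    by rewrite cats0; apply: letters_lt_pos.
  have := @skein_rel _ Hd n.+2 n _ _ (ltnSn _) lt_w2.
  rewrite !(skein_markov Hd) // !cats0 !IHn ?mulr0 ?subrr //; last by rewrite -[pos w]cats0.
  by move=> /esym/eqP; rewrite mulf_eq0 (negbTE z_neq0) => /eqP.
(* A single letter of top index is a stabilization. *)
rewrite -has_count has_pred1 => /split_first[u [v [eq_w nNu]]].
move: lt_w le1; rewrite eq_w all_cat count_cat /= eqxx (count_memPn nNu) add0n.
move=> /and3P[lt_u _ lt_v]; rewrite -[X in (_ <= X)%N]addn0 leq_add2l leqn0.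
move=> /eqP/count_memPn nNv.
have lt_uv : letters_lt n.+1 (pos u ++ pos v).
  rewrite -map_cat; apply: letters_lt_pos.
  by rewrite all_cat; apply/andP; split; apply: lt_top.
by rewrite /pos map_cat /= (skein_markov Hd) // IHn.
Qed.
End SkeinFunctional.

(** * Closed braid diagrams *)

#[local] Arguments slice_act : simpl never.

Definition crossings (w : seq (nat * bool)) : seq slice := [seq (g.1, Cross g.2) | g <- w].
Definition cups n : seq slice := [seq (k, Cup true) | k <- iota 0 n].
Definition caps n : seq slice := [seq (k, Cap) | k <- rev (iota 0 n)].
(** Counterpart of [closure_slices] with plain numbers as letters, so that one word can be closed on
    different numbers of strands. *)
Definition closure_diagram n w : seq slice := cups n ++ crossings w ++ caps n.
Definition strands n := nseq n true ++ nseq n false.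

Lemma crossings_cat u v : crossings (u ++ v) = crossings u ++ crossings v.
Proof. exact: map_cat. Qed.

Lemma cupsS n : cups n.+1 = cups n ++ [:: (n, Cup true)].
Proof. by rewrite /cups -addn1 iotaD map_cat. Qed.

Lemma capsS n : caps n.+1 = (n, Cap) :: caps n.
Proof. by rewrite /caps -addn1 iotaD rev_cat map_cat. Qed.

Lemma strandsS n : strands n.+1 = nseq n true ++ [:: true, false & nseq n false].
Proof. by rewrite /strands -addn1 nseqD -catA addn1. Qed.

Lemma slice_act_cross n i b p x y q : size p = i -> n = i ->
  slice_act (n, Cross b) (p ++ x :: y :: q) = Some (p ++ y :: x :: q).
Proof. by move=> <- ->; rewrite /slice_act /= drop_size_cat // take_size_cat. Qed.

Lemma slice_act_cap n i p x q : size p = i -> n = i ->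
  slice_act (n, Cap) (p ++ x :: ~~ x :: q) = Some (p ++ q).
Proof. by move=> <- ->; rewrite /slice_act /= drop_size_cat // take_size_cat //; case: x. Qed.

Lemma slice_act_cup n i d p q : size p = i -> n = i ->
  slice_act (n, Cup d) (p ++ q) = Some (p ++ d :: ~~ d :: q).
Proof.
by move=> <- ->; rewrite /slice_act /= size_cat leq_addr drop_size_cat // take_size_cat.
Qed.

Lemma slice_act_letter n i b : (i.+1 < n)%N ->
  slice_act (i, Cross b) (strands n) = Some (strands n).
Proof.
move=> lt_i; have eq_n : n = (i + (2 + (n - i - 2)))%N by move: lt_i; clear; lia.
rewrite /strands [X in nseq X true]eq_n !nseqD -!catA /=.
by rewrite (@slice_act_cross _ i) ?size_nseq.
Qed.

Lemma slices_act_letters n w : letters_lt n w ->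
  slices_act (crossings w) (strands n) = Some (strands n).
Proof.
by elim: w => // -[i b] w IH /andP[lt_i lt_w]; rewrite /= slice_act_letter //= IH.
Qed.

Lemma slice_act_innermost_cup n :
  slice_act (n, Cup true) (strands n) = Some (strands n.+1).
Proof. by rewrite (@slice_act_cup _ n) ?size_nseq // strandsS. Qed.

Lemma slice_act_innermost_cap n :
  slice_act (n, Cap) (strands n.+1) = Some (strands n).
Proof. by rewrite strandsS (@slice_act_cap _ n) ?size_nseq. Qed.

Lemma slices_act_closure n w : letters_lt n w ->
  slices_act (closure_diagram n w) [::] = Some [::].
Proof.
move=> lt_w; rewrite slices_act_cat slices_act_cups /= slices_act_cat.
by rewrite slices_act_letters //= slices_act_caps.
Qed.

(** * Isotopy invariants on closed braids *)

Section DiagramInvariant.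
Variables (F : Type) (x0 : F) (P : link_diagram -> F).
Hypothesis P_isotopic : forall D D', isotopic D D' -> P D = P D'.

(** The default [x0] on illegal lists of slices spares carrying legality proofs through each
    rewriting. *)
Definition diagram_value (D : seq slice) : F :=
  if insub D is Some L then P L else x0.

Lemma diagram_value_val L : diagram_value (val L) = P L.
Proof. by rewrite /diagram_value valK. Qed.

(** Since [m] and [m'] act alike on the level [s] reached by [A], the two diagrams are both legal,
    hence isotopic, or both illegal, with value [x0]. *)
Lemma diagram_value_move A m m' B s : local_move m m' ->
  slices_act A [::] = Some s -> slices_act m s = slices_act m' s ->
  diagram_value (A ++ m ++ B) = diagram_value (A ++ m' ++ B).
Proof.
move=> mm' As eq_mm'.
have eq_act : slices_act (A ++ m ++ B) [::] = slices_act (A ++ m' ++ B) [::].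
  by rewrite !slices_act_cat As /= !slices_act_cat eq_mm'.
rewrite /diagram_value; case: insubP => [L L_legal eq_L|]; last first.
  by rewrite eq_act; case: insubP => // L ->.
case: insubP => [L' _ eq_L'|]; last by rewrite -eq_act L_legal.
by apply/P_isotopic/rst_step; exists A, m, m', B; split.
Qed.

Let d n w := diagram_value (closure_diagram n w).

Lemma closure_move n u m m' v : local_move (crossings m) (crossings m') ->
  letters_lt n (u ++ v) -> letters_lt n m -> letters_lt n m' ->
  d n (u ++ m ++ v) = d n (u ++ m' ++ v).
Proof.
rewrite /letters_lt all_cat => mm' /andP[lt_u lt_v] lt_m lt_m'.
rewrite /d /closure_diagram !crossings_cat -!catA !(catA (cups n)).
apply: (@diagram_value_move _ _ _ _ (strands n)) => //.
  by rewrite slices_act_cat slices_act_cups /= slices_act_letters.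
by rewrite !slices_act_letters.
Qed.

Lemma slices_act_cups_letters n u : letters_lt n u ->
  slices_act (cups n ++ crossings u) [::] = Some (strands n).
Proof. by move=> lt_u; rewrite slices_act_cat slices_act_cups /= slices_act_letters. Qed.

(** Every letter of a word on [n] strands lies to the left of the innermost cup, so far commutation
    lifts the cup past it. *)
Lemma cup_past_letters n u w B : letters_lt n (u ++ w) ->
  diagram_value (cups n ++ crossings u ++ (n, Cup true) :: crossings w ++ B)
  = diagram_value (cups n ++ crossings (u ++ w) ++ (n, Cup true) :: B).
Proof.
elim: w u => [|[i b] w IH] u; first by rewrite cats0.
move=> lt_uw; move: (lt_uw); rewrite /letters_lt all_cat /= => /and3P[lt_u lt_i lt_w].
rewrite -cat_rcons -IH ?cat_rcons // -cats1 crossings_cat /= -catA /=.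
rewrite !(catA (cups n)) -[(n, Cup true) :: _]cat1s.
rewrite -[_ ++ (i, Cross b) :: _]/([:: (n, Cup true); (i, Cross b)] ++ crossings w ++ B).
rewrite -[[:: (i, Cross b), _ & _]]/([:: (i, Cross b); (n, Cup true)] ++ crossings w ++ B).
apply: (@diagram_value_move _ _ _ _ (strands n)).
- by have := @mv_far i (Cross b) n (Cup true); rewrite /= subnK; [apply|]; lia.
- exact: slices_act_cups_letters.
- rewrite /= slice_act_innermost_cup /= (slice_act_letter _ lt_i) /=.
  by rewrite slice_act_innermost_cup slice_act_letter // ltnW.
Qed.

Lemma letters_past_cap n A w B : slices_act A [::] = Some (strands n.+1) ->
  letters_lt n w ->
  diagram_value (A ++ crossings w ++ (n, Cap) :: B)
  = diagram_value (A ++ (n, Cap) :: crossings w ++ B).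
Proof.
elim: w A => // -[i b] w IH A act_A /andP[/= lt_i lt_w].
have := IH (rcons A (i, Cross b)); rewrite !cat_rcons => -> //; last first.
  by rewrite -cats1 slices_act_cat act_A /= slice_act_letter // ltnW.
rewrite -[LHS]/(diagram_value (A ++ [:: (i, Cross b); (n, Cap)] ++ crossings w ++ B)).
rewrite -[RHS]/(diagram_value (A ++ [:: (n, Cap); (i, Cross b)] ++ crossings w ++ B)).
apply/esym; apply: (@diagram_value_move _ _ _ _ (strands n.+1)) => //.
  by have := @mv_far i (Cross b) n Cap; rewrite /= subnK; [apply|]; lia.
have lt_i' : (i.+1 < n.+1)%N by apply: ltnW.
rewrite /= slice_act_innermost_cap /= (slice_act_letter _ lt_i') /=.
by rewrite slice_act_innermost_cap slice_act_letter.
Qed.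

(* Sliding the cup across the strand to its left leaves a Reidemeister-I curl on the cap, then a zigzag. *)
Lemma kink_removal n b A B : slices_act A [::] = Some (strands n.+1) ->
  diagram_value (A ++ [:: (n.+1, Cup true), (n, Cross b), (n.+1, Cap) & B])
  = diagram_value (A ++ B).
Proof.
move=> act_A.
(* The slid cup yields a level that is not of the form [strands]: a downward strand stands to the
   left of an upward one. *)
have act_cup' : slice_act (n, Cup true) (strands n.+1) =
    Some (rcons (nseq n true) true ++ [:: false, true & false :: nseq n false]).
  by rewrite strandsS (@slice_act_cup _ n) ?size_nseq // cat_rcons.
have size_n : size (rcons (nseq n true) true) = n.+1 by rewrite size_rcons size_nseq.
have strands2 : strands n.+2 = rcons (nseq n true) true ++ [:: true, false & false :: nseq n false].
  by rewrite strandsS -cats1 -[[:: true]]/(nseq 1 true) -nseqD addn1.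
transitivity (diagram_value (A ++ [:: (n, Cup true); (n.+1, Cross (~~ b))] ++ (n.+1, Cap) :: B)).
  rewrite -[LHS]/(diagram_value (A ++ [:: (n.+1, Cup true); (n, Cross b)] ++ (n.+1, Cap) :: B)).
  apply/esym; apply: (@diagram_value_move _ _ _ _ (strands n.+1)) => //.
    by have := mv_cup_cross n true (~~ b); rewrite negbK.
  rewrite /= act_cup' slice_act_innermost_cup /= slice_act_letter //.
  by rewrite (@slice_act_cross _ n.+1) //= strands2.
transitivity (diagram_value ((A ++ [:: (n, Cup true)]) ++ [:: (n.+1, Cap)] ++ B)).
  rewrite -[RHS](@diagram_value_move _ [:: (n.+1, Cross (~~ b)); (n.+1, Cap)] _ _
    (rcons (nseq n true) true ++ [:: false, true & false :: nseq n false])).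
  - by rewrite -!catA.
  - exact: mv_R1_cap.
  - by rewrite slices_act_cat act_A /= act_cup'.
  - rewrite /= (@slice_act_cross _ n.+1) //=.
    by rewrite (@slice_act_cap _ n.+1 _ true) // (@slice_act_cap _ n.+1 _ false).
rewrite -catA -[LHS]/(diagram_value (A ++ [:: (n, Cup true); (n.+1, Cap)] ++ B)).
rewrite (@diagram_value_move _ _ [::] _ (strands n.+1)) //; first exact: mv_zigzag_l.
rewrite /= act_cup' /= (@slice_act_cap _ n.+1 _ false) //=.
by rewrite strandsS cat_rcons.
Qed.

(** The innermost cup is lifted above [u] and the innermost cap lowered below [v]; together with the
    stabilizing crossing they form a kink. *)
Lemma closure_markov n b u v : letters_lt n.+1 (u ++ v) ->
  d n.+2 (u ++ (n, b) :: v) = d n.+1 (u ++ v).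
Proof.
rewrite /letters_lt all_cat => /andP[lt_u lt_v].
rewrite /d /closure_diagram cupsS capsS !crossings_cat -!catA /=.
have := @cup_past_letters n.+1 [::] u; rewrite /= => -> //.
pose A := (cups n.+1 ++ crossings u) ++ [:: (n.+1, Cup true); (n, Cross b)].
transitivity (diagram_value (A ++ crossings v ++ (n.+1, Cap) :: caps n.+1)).
  by rewrite /A -!catA.
rewrite letters_past_cap //; last first.
  rewrite slices_act_cat slices_act_cups_letters //=.
  by rewrite slice_act_innermost_cup /= slice_act_letter.
by rewrite -catA kink_removal ?slices_act_cups_letters // -?catA.
Qed.

End DiagramInvariant.

Lemma HOMFLYPT_skein_functional (R : realType) (PH : link_diagram -> laurent)
    (a z : R[i]) : is_HOMFLYPT R PH -> a != 0 -> z != 0 ->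
  skein_functional a z
    (fun n w => diagram_value 0 (fun D => laurent_eval (PH D) a z) (closure_diagram n w)).
Proof.
case=> PH_iso _ PH_skein a_neq0 z_neq0.
have iso D D' : isotopic D D' -> laurent_eval (PH D) a z = laurent_eval (PH D') a z.
  by move=> /PH_iso ->.
split=> [n i u v lt_i lt_uv|n i u v lt_i lt_uv|n i j u v lt_ij lt_j lt_uv|n i u v lt_i lt_uv|*].
- have legal m : letters_lt n m ->
      slices_act (closure_diagram n (u ++ m ++ v)) [::] == Some [::].
    move=> lt_m; rewrite slices_act_closure //.
    by move: lt_uv lt_m; rewrite /letters_lt !all_cat => /andP[-> ->] ->.
  have lt1 b : letters_lt n [:: (i, b)] by rewrite /letters_lt /= lt_i.
  have lt_u : letters_lt n u by move: lt_uv; rewrite /letters_lt all_cat => /andP[].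
  (* Both strands at a letter point upwards, so the sign of [Cross b] is [b] and the oriented
     smoothing inserts no slice. *)
  have [nth_i nth_i1] : nth true (strands n) i = true /\ nth true (strands n) i.+1 = true.
    by rewrite !nth_cat !size_nseq lt_i (ltnW lt_i) !nth_nseq !if_same.
  pose L m lt_m : link_diagram := exist _ (closure_diagram n (u ++ m ++ v)) (legal m lt_m).
  have := PH_skein (L _ (lt1 true)) (L _ (lt1 false)) (L [::] isT) _ a z a_neq0 z_neq0.
  rewrite -!(diagram_value_val 0 (fun D => laurent_eval (PH D) a z)); apply.
  exists (cups n ++ crossings u), (crossings v ++ caps n), (strands n), i.
  rewrite nth_i nth_i1 /= slices_act_cups_letters //= /closure_diagram !crossings_cat.
  split=> //; rewrite -?catA //=.
  by rewrite size_cat !size_nseq ltn_addr.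
- apply: (@closure_move _ _ _ iso _ _ [:: (i, true); (i, false)] [::]) => //.
    exact: mv_R2.
  by rewrite /letters_lt /= lt_i.
- apply: (@closure_move _ _ _ iso _ _ [:: (j, true); (i, true)] [:: (i, true); (j, true)]) => //.
  + by have := @mv_far i (Cross true) j (Cross true); rewrite /= subnK; [apply|]; lia.
  + by rewrite /letters_lt /= lt_j (ltn_trans lt_ij) // ltnW.
  + by rewrite /letters_lt /= lt_j (ltn_trans lt_ij) // ltnW.
- apply/esym.
  apply: (@closure_move _ _ _ iso _ _ [:: (i, true); (i.+1, true); (i, true)]
    [:: (i.+1, true); (i, true); (i.+1, true)]) => //.
  + exact: mv_R3.
  + by rewrite /letters_lt /= lt_i ltnW.
  + by rewrite /letters_lt /= lt_i ltnW.
- exact: closure_markov.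
Qed.

(** * Braid matrices *)

Lemma cube_root_unity (F : comPzRingType) (w : F) : 1 + w + w ^+ 2 = 0 -> w ^+ 3 = 1.
Proof.
move=> w_root; apply/subr0_eq; transitivity ((w - 1) * (1 + w + w ^+ 2)); first by ring.
by rewrite w_root mulr0.
Qed.

Section Gate.
Variables (F : fieldType) (w s : F).
Hypotheses (w_root : 1 + w + w ^+ 2 = 0) (s_sqr : s ^+ 2 = 3) (s_neq0 : s != 0).

Let w_cube : w ^+ 3 = 1.
Proof. exact: cube_root_unity. Qed.

Definition gate_sum n (U : 'M[F]_n) := 1%:M + U + w *: (U *m U).
Definition gate n (U : 'M[F]_n) := s^-1 *: gate_sum U.
Definition gateV n (U : 'M[F]_n) := s^-1 *: (1%:M + w ^+ 2 *: U + U *m U).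

Section Relations.
Variables (n : nat) (U V : 'M[F]_n).
Hypotheses (U3 : U *m U *m U = 1%:M) (V3 : V *m V *m V = 1%:M).

Lemma gateK : gate U *m gateV U = 1%:M.
Proof.
rewrite /gate /gateV -scalemxAl -scalemxAr scalerA -invfM -expr2 s_sqr.
have -> : gate_sum U *m (1%:M + w ^+ 2 *: U + U *m U) = 3 *: 1%:M.
  rewrite /gate_sum !mulmxDl !mulmxDr !mul1mx !mulmx1 -!scalemxAl -!scalemxAr !mulmxA U3 mul1mx.
  move: (U *m U) => U2; apply/matrixP => i j; rewrite !mxE; set x := (i == j)%:R.
  (* The two sides differ by a multiple of [1 + w + w^2]; its cofactor is supplied explicitly for
     [ring]. *)
  rewrite -[RHS]addr0 -[0 in RHS](mul0r ((w - 1) * x + U i j + U2 i j)) -w_root; ring.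
by rewrite scalerA mulVf ?scale1r // -s_sqr expf_neq0.
Qed.

Lemma gate_comm : U *m V = V *m U -> gate U *m gate V = gate V *m gate U.
Proof.
move=> UV; rewrite /gate -!scalemxAl -!scalemxAr; do 2!congr (_ *: _).
rewrite /gate_sum !mulmxDl !mulmxDr !mul1mx !mulmx1 -!scalemxAl -!scalemxAr.
have UV2 : U *m (V *m V) = V *m V *m U by rewrite mulmxA UV -mulmxA UV mulmxA.
have U2V : U *m U *m V = V *m (U *m U) by rewrite -mulmxA UV mulmxA UV mulmxA.
have U2V2 : U *m U *m (V *m V) = V *m V *m (U *m U).
  by rewrite -mulmxA UV2 mulmxA UV2 mulmxA.
rewrite UV UV2 U2V U2V2; move: (U *m U) (V *m V) => U2 V2.
move: (V *m U) (V2 *m U) (V *m U2) (V2 *m U2) => M1 M2 M3 M4.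
by apply/matrixP => i j; rewrite !mxE; ring.
Qed.

Hypothesis VU : V *m U = w *: (U *m V).

Let VVU : V *m V *m U = w ^+ 2 *: (U *m V *m V).
Proof. by rewrite -mulmxA VU -scalemxAr mulmxA VU -scalemxAl scalerA. Qed.

Let UV : U *m V = w ^+ 2 *: (V *m U).
Proof. by rewrite VU scalerA -exprSr w_cube scale1r. Qed.

Let UUV : U *m U *m V = w *: (V *m U *m U).
Proof.
rewrite -mulmxA UV -scalemxAr mulmxA UV -scalemxAl scalerA -exprD.
by rewrite exprSr w_cube mul1r.
Qed.

(** Moving [U] to the left rescales [V] by [w] and turns [1 + V + w V^2] into [1 + w V + V^2], which
    is [V^2] times the original sum because [V^3 = 1]. The companion rule for [V] is similar, with a
    phase [w^2]. *)
Let gate_sum_VU : gate_sum V *m U = U *m V *m V *m gate_sum V.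
Proof.
rewrite /gate_sum !mulmxDl !mulmxDr !mul1mx !mulmx1 -!scalemxAl -!scalemxAr VU VVU.
rewrite scalerA -exprS w_cube scale1r.
have -> : U *m V *m V *m V = U by rewrite -2!mulmxA (mulmxA V) V3 mulmx1.
have -> : U *m V *m V *m (V *m V) = U *m V.
  by rewrite mulmxA -!mulmxA (mulmxA V V) (mulmxA _ V) V3 ?mul1mx ?mulmx1.
by rewrite addrC addrA.
Qed.

Let gate_sum_UV : gate_sum U *m V = w ^+ 2 *: (V *m U *m gate_sum U).
Proof.
rewrite /gate_sum !mulmxDl !mulmxDr !mul1mx !mulmx1 -!scalemxAl -!scalemxAr UV UUV.
have -> : V *m U *m (U *m U) = V by rewrite -!mulmxA (mulmxA U) U3 mulmx1.
rewrite !scalerDr !scalerA -exprSr w_cube scale1r -expr2.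
move: (V *m U) => VU'; move: (VU' *m U) => VUU.
by apply/matrixP => i j; rewrite !mxE; ring.
Qed.

(** Apply the two preceding rules in turn; the phases multiply to [w^3 = 1] and the powers of [V] to
    [V^3 = 1]. *)
Let gate_sum_braid_conj :
  gate_sum V *m gate_sum U *m V = U *m (gate_sum V *m gate_sum U).
Proof.
have VS : gate_sum V *m V = V *m gate_sum V.
  by rewrite /gate_sum !mulmxDl !mulmxDr mul1mx mulmx1 -scalemxAl -scalemxAr mulmxA.
rewrite -mulmxA gate_sum_UV -scalemxAr !mulmxA VS -(mulmxA V) gate_sum_VU.
rewrite !mulmxA VU -!scalemxAl scalerA -exprSr w_cube scale1r.
by rewrite -(mulmxA U V V) -(mulmxA U) V3 mulmx1.
Qed.

(* Conjugation by the product of the two gates carries [V] to [U], hence [gate V] to [gate U]. *)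
Lemma gate_braid : gate V *m gate U *m gate V = gate U *m gate V *m gate U.
Proof.
rewrite /gate -!scalemxAl -!scalemxAr -!scalemxAl; do 3!congr (_ *: _).
have := gate_sum_braid_conj; rewrite -[gate_sum U *m _ *m _]mulmxA.
move: (gate_sum V *m gate_sum U) => T TV.
rewrite [in LHS]/gate_sum [in RHS]/gate_sum !mulmxDl !mulmxDr mul1mx mulmx1.
by rewrite -scalemxAl -scalemxAr mulmxA TV -!mulmxA TV.
Qed.
End Relations.

(** Since [w^-1 = w^2], the coefficients of [U] and [U^2] cancel and only the scalar [(w - w^2) / s]
    survives. *)
Lemma gate_skein n (U : 'M[F]_n) z : z * s = w - w ^+ 2 ->
  w *: gate U - w^-1 *: gateV U = z *: 1%:M.
Proof.
have -> : w^-1 = w ^+ 2.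
  have w_neq0 : w != 0 by apply: contra_eq_neq w_cube => ->; rewrite expr0n eq_sym oner_eq0.
  by apply: (mulfI w_neq0); rewrite mulfV // -exprS w_cube.
move=> /(canRL (mulfK s_neq0)) ->; rewrite /gate /gateV /gate_sum.
move: (U *m U) => U2; apply/matrixP => i j; rewrite !mxE.
set x := (i == j)%:R; rewrite -[RHS]addr0.
have -> : 0 = (s^-1 * (w - w ^+ 2)) * U i j * (1 + w + w ^+ 2) by rewrite w_root mulr0.
ring.
Qed.

(** Conjugation by [K] multiplies [U] by [w] and [U^2] by [w^2], so [w^2 (U + U^2)] becomes
    [U + w U^2]. *)
Lemma gate_conj n (U K K' : 'M[F]_n) : K *m K' = 1%:M -> K *m U = w *: (U *m K) ->
  K *m (s^-1 *: (1%:M + w ^+ 2 *: (U + U *m U))) *m K' = gate U.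
Proof.
move=> KK' KU; have KUU : K *m (U *m U) = w ^+ 2 *: (U *m U *m K).
  by rewrite mulmxA KU -scalemxAl -mulmxA KU -scalemxAr scalerA mulmxA.
rewrite -scalemxAr -scalemxAl; congr (_ *: _).
rewrite mulmxDr mulmx1 -scalemxAr mulmxDr KU KUU scalerDr !scalerA.
rewrite -exprSr -exprD w_cube (exprD _ 1 3) w_cube mulr1 scale1r.
by rewrite !mulmxDl -scalemxAl -!(mulmxA _ K) KK' !mulmx1 addrA.
Qed.
End Gate.

(** * Tensor products, traces and operators on single tensor factors *)

Lemma tens1mx1 (F : comPzRingType) m n : (1%:M : 'M[F]_m) *t (1%:M : 'M[F]_n) = 1%:M.
Proof.
apply/matrixP => i j; case: (mxtens_indexP i) => i1 i2; case: (mxtens_indexP j) => j1 j2.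
rewrite tensmxE !mxE (can_eq (@mxtens_indexK _ _)) xpair_eqE.
by do 2!case: eqP => _; rewrite ?mulr1 ?mulr0 ?mul0r.
Qed.

Lemma mxtrace_tens (F : comPzRingType) m n (A : 'M[F]_m) (B : 'M[F]_n) :
  \tr (A *t B) = \tr A * \tr B.
Proof. by rewrite /mxtrace mulr_sum; apply: eq_bigr => i _; rewrite mxE. Qed.

(** Conjugation by [W] preserves the trace of [Y] but multiplies [Y] by [c]. *)
Lemma mxtrace_twisted_commute (F : fieldType) n (c : F) (W W' Y : 'M[F]_n) :
  W *m W' = 1%:M -> W *m Y = c *: (Y *m W) -> c != 1 -> \tr Y = 0.
Proof.
move=> WW' WY c_neq1; have : \tr Y = c * \tr Y.
  rewrite -[Y in LHS]mulmx1 -(mulmx1C WW') mulmxA mxtrace_mulC mulmxA WY.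
  by rewrite -scalemxAl mxtraceZ -mulmxA WW' mulmx1.
move=> /eqP; rewrite -subr_eq0 -[X in X - _]mul1r -mulrBl mulf_eq0 subr_eq0 eq_sym.
by rewrite (negbTE c_neq1) => /eqP.
Qed.

(** The recursion splits off the last tensor factor definitionally, so that [site] is defined
    without casts. *)
Fixpoint dim3 n := if n is m.+1 then (dim3 m * 3)%N else 1%N.

Lemma mulmx_commM (F : pzRingType) n (A B C : 'M[F]_n) :
  A *m C = C *m A -> B *m C = C *m B -> A *m B *m C = C *m (A *m B).
Proof. by move=> comm_AC comm_BC; rewrite -mulmxA comm_BC mulmxA comm_AC mulmxA. Qed.

Section Sites.
Variable F : fieldType.

(** The operator [M] on tensor factor [k], counted from 0; the identity when [k] is not less than
    [n]. *)
Fixpoint site n k (M : 'M[F]_3) : 'M[F]_(dim3 n) :=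
  if n is m.+1 return 'M_(dim3 n) then
    if k == m then 1%:M *t M else site m k M *t 1%:M
  else 1%:M.

Lemma site_last n M : site n.+1 n M = 1%:M *t M.
Proof. by rewrite /= eqxx. Qed.

Lemma siteS n k M : (k < n)%N -> site n.+1 k M = site n k M *t 1%:M.
Proof. by move=> lt_kn; rewrite /= ltn_eqF. Qed.

Lemma site1 n k : site n k 1%:M = 1%:M.
Proof. by elim: n => //= n IH; rewrite IH if_same tens1mx1. Qed.

Lemma siteM n k M N : site n k (M *m N) = site n k M *m site n k N.
Proof.
elim: n => [|n IH] /=; first by rewrite mulmx1.
by case: ifP => _; rewrite tensmx_mul mulmx1 ?IH.
Qed.

Lemma siteZ n k c M : (k < n)%N -> site n k (c *: M) = c *: site n k M.
Proof.
elim: n => //= n IH lt_k; case: ifP => [_|neq].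
  by apply/matrixP => i j; rewrite !mxE mulrCA.
rewrite IH; last by move: lt_k; rewrite ltnS leq_eqVlt neq.
by apply/matrixP => i j; rewrite !mxE mulrA.
Qed.

Lemma site_comm n k l M N : k != l -> site n k M *m site n l N = site n l N *m site n k M.
Proof.
move=> neq_kl; elim: n => //= n IH.
case: eqP => [eq_k|_]; case: eqP => [eq_l|_]; rewrite !tensmx_mul ?mul1mx ?mulmx1 ?IH //.
by rewrite eq_k eq_l eqxx in neq_kl.
Qed.

Variables (w : F) (Z X : 'M[F]_3).
Hypotheses (Z3 : Z *m Z *m Z = 1%:M) (X3 : X *m X *m X = 1%:M) (ZX : Z *m X = w *: (X *m Z)).

Definition site_U n i := site n i Z *m site n i.+1 X.

Lemma site_US n i : (i.+1 < n)%N -> site_U n.+1 i = site_U n i *t 1%:M.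
Proof.
move=> lt_i; rewrite /site_U (siteS _ lt_i) (siteS _ (ltnW lt_i)).
by rewrite tensmx_mul mulmx1.
Qed.

Lemma site_U_cube n i : site_U n i *m site_U n i *m site_U n i = 1%:M.
Proof.
have neq : i.+1 != i by rewrite gtn_eqF.
have comm M N : site n i.+1 M *m site n i N = site n i N *m site n i.+1 M by rewrite site_comm.
have U2 : site_U n i *m site_U n i = site n i (Z *m Z) *m site n i.+1 (X *m X).
  by rewrite /site_U mulmxA -(mulmxA (site n i Z)) comm !mulmxA -siteM -mulmxA -siteM.
rewrite U2 /site_U mulmxA -(mulmxA (site n i _)) comm !mulmxA -siteM -mulmxA -siteM.
by rewrite Z3 X3 !site1 mulmx1.
Qed.

Lemma site_U_far n i j : (i.+1 < j)%N -> site_U n i *m site_U n j = site_U n j *m site_U n i.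
Proof.
move=> lt_ij; have comm k M l N : (k <= i.+1)%N -> (j <= l)%N ->
    site n k M *m site n l N = site n l N *m site n k M.
  by move=> le_k le_l; apply/site_comm; rewrite ltn_eqF // (leq_trans _ le_l) // (leq_ltn_trans le_k).
by apply: mulmx_commM; apply/esym; apply: mulmx_commM; apply/esym; apply: comm.
Qed.

(** The two operators overlap only in factor [i.+1], where one acts by [X] and the other by [Z]; the
    phase is that of [ZX]. *)
Lemma site_U_next n i : (i.+2 < n)%N ->
  site_U n i.+1 *m site_U n i = w *: (site_U n i *m site_U n i.+1).
Proof.
move=> lt_i; rewrite /site_U.
have comm_X : site n i.+2 X *m (site n i Z *m site n i.+1 X) =
    site n i Z *m site n i.+1 X *m site n i.+2 X.
  by apply/esym/mulmx_commM; apply: site_comm; rewrite ltn_eqF.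
rewrite -mulmxA comm_X mulmxA (mulmxA (site n i.+1 Z)) (@site_comm _ i.+1 i) ?gtn_eqF //.
rewrite -(mulmxA (site n i Z)) -siteM ZX siteZ ?(ltnW lt_i) //.
by rewrite -scalemxAr -scalemxAl siteM !mulmxA.
Qed.

Lemma site_last_twist n :
  site n.+2 n.+1 Z *m site_U n.+2 n = w *: (site_U n.+2 n *m site n.+2 n.+1 Z).
Proof.
rewrite /site_U mulmxA site_comm ?gtn_eqF // -mulmxA -siteM ZX siteZ // siteM.
by rewrite -scalemxAr mulmxA.
Qed.

Variable s : F.
Hypotheses (w_root : 1 + w + w ^+ 2 = 0) (s_sqr : s ^+ 2 = 3) (s_neq0 : s != 0).

Definition word_mx n (x : seq (nat * bool)) : 'M[F]_(dim3 n) :=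
  \big[mulmx/1%:M]_(g <- x)
    (if g.2 then gate w s (site_U n g.1) else gateV w s (site_U n g.1)).

Lemma word_mx_cat n u v : word_mx n (u ++ v) = word_mx n u *m word_mx n v.
Proof.
rewrite /word_mx; elim: u => [|g u IH] /=; first by rewrite big_nil mul1mx.
by rewrite !big_cons IH mulmxA.
Qed.

Lemma word_mx_cons n g v : word_mx n (g :: v) =
  (if g.2 then gate w s (site_U n g.1) else gateV w s (site_U n g.1)) *m word_mx n v.
Proof. by rewrite /word_mx big_cons. Qed.

Lemma tens_gate m n (U : 'M[F]_m) : gate w s (U *t (1%:M : 'M_n)) = gate w s U *t 1%:M.
Proof.
rewrite /gate /gate_sum tensmx_mul mulmx1 -tens1mx1.
by apply/matrixP => i j; rewrite !mxE; ring.
Qed.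

Lemma tens_gateV m n (U : 'M[F]_m) : gateV w s (U *t (1%:M : 'M_n)) = gateV w s U *t 1%:M.
Proof.
rewrite /gateV tensmx_mul mulmx1 -tens1mx1.
by apply/matrixP => i j; rewrite !mxE; ring.
Qed.

Lemma word_mxS n x : letters_lt n x -> word_mx n.+1 x = word_mx n x *t 1%:M.
Proof.
elim: x => [|[i b] x IH] /=; first by rewrite /word_mx !big_nil tens1mx1.
move=> /andP[/= lt_i /IH eq_x]; rewrite !word_mx_cons eq_x /= site_US //.
by rewrite tens_gate tens_gateV; case: b; rewrite tensmx_mul mulmx1.
Qed.

Hypothesis w_neq1 : w != 1.

Let w_cube : w ^+ 3 = 1.
Proof. exact: cube_root_unity. Qed.

Let w2_neq1 : w ^+ 2 != 1.
Proof.
by apply: contra_neq w_neq1 => w2; rewrite -w_cube exprSr w2 mul1r.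
Qed.

Lemma word_mx_last_comm n x : letters_lt n x ->
  site n.+1 n Z *m word_mx n.+1 x = word_mx n.+1 x *m site n.+1 n Z.
Proof.
move=> lt_x; rewrite word_mxS // site_last !tensmx_mul mulmx1 mul1mx.
by rewrite mulmx1 mul1mx.
Qed.

(** The clock on the last factor commutes with words on the other strands, so it twists the whole
    product by [w ^+ k]. The cases [k = 1] and [k = 2] serve [U] and [U^2]. *)
Lemma mxtrace_word_U n k u v (Uk : 'M[F]_(dim3 n.+2)) :
  letters_lt n.+1 u -> letters_lt n.+1 v -> w ^+ k != 1 ->
  site n.+2 n.+1 Z *m Uk = w ^+ k *: (Uk *m site n.+2 n.+1 Z) ->
  \tr (word_mx n.+2 u *m Uk *m word_mx n.+2 v) = 0.
Proof.
move=> lt_u lt_v wk_neq1 ZU; have ZZ : site n.+2 n.+1 Z *m site n.+2 n.+1 (Z *m Z) = 1%:M.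
  by rewrite -siteM mulmxA Z3 site1.
apply: mxtrace_twisted_commute ZZ _ wk_neq1.
rewrite mulmxA [site _ _ _ *m _]mulmxA word_mx_last_comm // -(mulmxA (word_mx _ u)) ZU.
rewrite -scalemxAr -scalemxAl; congr (_ *: _).
by rewrite -!mulmxA word_mx_last_comm.
Qed.

(* Conjugation by the clock on the last strand multiplies [U] by [w] and fixes the lower letters, so only the
   identity term of the last gate has a nonzero trace. *)
Lemma mxtrace_word_markov n b u v : letters_lt n.+1 u -> letters_lt n.+1 v ->
  \tr (word_mx n.+2 (u ++ (n, b) :: v)) = s * \tr (word_mx n.+1 (u ++ v)).
Proof.
move=> lt_u lt_v; rewrite word_mx_cat word_mx_cons /=.
set U := site_U n.+2 n.
have ZU := site_last_twist n; have tr1 := mxtrace_word_U (k := 1) lt_u lt_v w_neq1 ZU.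
have ZU2 : site n.+2 n.+1 Z *m (U *m U) = w ^+ 2 *: (U *m U *m site n.+2 n.+1 Z).
  by rewrite mulmxA ZU -scalemxAl -mulmxA ZU -scalemxAr scalerA mulmxA.
have tr2 := mxtrace_word_U lt_u lt_v w2_neq1 ZU2.
have tr0 : \tr (word_mx n.+2 u *m word_mx n.+2 v) = 3 * \tr (word_mx n.+1 (u ++ v)).
  rewrite -word_mx_cat word_mxS ?mxtrace_tens ?mxtrace1 1?mulrC //.
  by rewrite /letters_lt all_cat -!/(letters_lt _ _) lt_u.
(* The trace 3 of the identity on the extra factor and the normalization [s^-1] of the gate combine
   to [s]. *)
have s_inv : s^-1 * 3 = s by rewrite -s_sqr expr2 mulKf.
rewrite mulmxA; case: b; rewrite /gate /gate_sum /gateV -scalemxAr -scalemxAl mxtraceZ;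
  rewrite !mulmxDr !mulmxDl !raddfD /= mulmx1 -!scalemxAr -!scalemxAl !mxtraceZ;
  by rewrite tr0 tr1 tr2 !mulr0 !addr0 mulrA s_inv.
Qed.

Variable z : F.
Hypothesis zs : z * s = w - w ^+ 2.

Definition word_value n x := s^-1 * (s ^- n * \tr (word_mx n x)).

Lemma word_value_skein_functional : skein_functional w z word_value.
Proof.
split=> [n i u v lt_i lt_uv|n i u v lt_i lt_uv|n i j u v lt_ij lt_j lt_uv|n i u v lt_i lt_uv|n b u v].
- rewrite /word_value !word_mx_cat !word_mx_cons /= ![_ *m (_ *m word_mx n v)]mulmxA.
  have lin (c : F) (A : 'M_(dim3 n)) : c * (s^-1 * (s ^- n * \tr (word_mx n u *m A *m word_mx n v)))
      = s^-1 * (s ^- n * \tr (word_mx n u *m (c *: A) *m word_mx n v)).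
    by rewrite -scalemxAr -scalemxAl mxtraceZ; ring.
  rewrite -[word_mx n u in RHS]mulmx1 !lin -!mulrBr -raddfB /= -mulmxBl -mulmxBr.
  by rewrite (gate_skein w_root s_neq0 _ zs).
- rewrite /word_value !word_mx_cat !word_mx_cons /= (mulmxA _ _ (word_mx n v)).
  by rewrite (gateK w_root s_sqr s_neq0) ?mul1mx // site_U_cube.
- rewrite /word_value !word_mx_cat !word_mx_cons /= !(mulmxA _ _ (word_mx n v)).
  by rewrite gate_comm // (site_U_far _ lt_ij).
- rewrite /word_value !word_mx_cat !word_mx_cons /= !(mulmxA _ _ (word_mx n v)).
  by rewrite !(mulmxA (gate w s _)) (gate_braid _ w_root) ?site_U_cube // site_U_next.
- rewrite {1}/letters_lt all_cat => /andP[lt_u lt_v].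
  by rewrite /word_value mxtrace_word_markov // exprSr invfM -!mulrA mulKf.
Qed.

Lemma word_value_unknot : word_value 1 [::] = 1.
Proof.
by rewrite /word_value /word_mx big_nil mxtrace1 /= expr1 mulrA -invfM -expr2 s_sqr mulVf // -s_sqr expf_neq0.
Qed.

End Sites.

(** * Matrices up to equality of dimensions *)

Lemma invmx_eq (F : comUnitRingType) n (A B : 'M[F]_n) : A *m B = 1%:M -> invmx A = B.
Proof. by move=> AB; rewrite -[RHS](mulKmx (mulmx1_unit AB).1) AB mulmx1. Qed.

(* Equality of square matrices whose dimensions are only propositionally equal. *)
Section TaggedMatrix.
Variable F : fieldType.

Definition sq n (A : 'M[F]_n) : {n & 'M[F]_n} := existT _ n A.

Lemma sq_transport m n (A : 'M[F]_m) (B : 'M[F]_n) :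
  sq A = sq B -> forall P : forall k, 'M[F]_k -> Prop, P m A -> P n B.
Proof.
by move=> AB P; have := f_equal (fun S => P (tag S) (tagged S)) AB => /= ->.
Qed.

Lemma sq_cast m n (e : m = n) (A : 'M[F]_m) : sq (castmx (e, e) A) = sq A.
Proof. by case: n / e; rewrite castmx_id. Qed.

Lemma sq_tens m m' n n' (A : 'M[F]_m) (A' : 'M[F]_m') (B : 'M[F]_n) (B' : 'M[F]_n') :
  sq A = sq A' -> sq B = sq B' -> sq (A *t B) = sq (A' *t B').
Proof.
move=> AA' BB'; apply: (sq_transport AA' (P := fun k M => sq (A *t B) = sq (M *t B'))).
exact: (sq_transport BB' (P := fun k M => sq (A *t B) = sq (A *t M))).
Qed.

Lemma sq_mul m n (A A' : 'M[F]_m) (B B' : 'M[F]_n) :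
  sq A = sq B -> sq A' = sq B' -> sq (A *m A') = sq (B *m B').
Proof.
move=> AB; apply: (sq_transport AB
  (P := fun k M => forall N : 'M_k, sq A' = sq N -> sq (A *m A') = sq (M *m N))).
(* Dimensions have decidable equality, so equal pairs over the same dimension have equal
   matrices. *)
by move=> N /eqP; rewrite -tag_eqE /tag_eq /= eqxx /= tagged_asE => /eqP ->.
Qed.

Lemma sq_tensA m n p (A : 'M[F]_m) (B : 'M[F]_n) (C : 'M[F]_p) :
  sq (A *t B *t C) = sq (A *t (B *t C)).
Proof.
rewrite -(sq_cast (esym (mulnA m n p))); congr sq; apply/matrixP => i j.
(* An index of the triple product is decomposed by quotients and remainders in two orders; these
   identities match the three components. *)
have div_div k : (k %/ p %/ n = k %/ (n * p))%N by rewrite mulnC divnMA.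
have div_mod k : ((k %/ p) %% n = k %% (n * p) %/ p)%N by rewrite modn_divl.
have mod_mod k : (k %% p = k %% (n * p) %% p)%N by rewrite modn_dvdm // dvdn_mull.
rewrite castmxE !mxE -mulrA.
by congr (A _ _ * (B _ _ * C _ _)); apply: val_inj => /=.
Qed.

Lemma sq_tensmx1 m (A : 'M[F]_m) : sq (A *t (1%:M : 'M_1)) = sq A.
Proof. by rewrite tens_mx_scalar scale1r sq_cast. Qed.

Lemma dim3E n : dim3 n = (3 ^ n)%N.
Proof. by elim: n => //= n ->; rewrite expnSr. Qed.

Lemma sq1 m n : m = n -> sq (1%:M : 'M[F]_m) = sq (1%:M : 'M[F]_n).
Proof. by move->. Qed.

(** Induction on the number [c] of factors to the right; the sum [c + a.+2] lets each of them appear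
    as a successor that [siteS] peels off. *)
Lemma sq_site a c (A B : 'M[F]_3) :
  sq ((1%:M : 'M_(3 ^ a)) *t (A *t B) *t (1%:M : 'M_(3 ^ c)))
  = sq (site (c + a.+2) a A *m site (c + a.+2) a.+1 B).
Proof.
elim: c => [|c IH].
  rewrite sq_tensmx1 -sq_tensA add0n site_last siteS // site_last tensmx_mul mulmx1 mul1mx.
  by do 2!apply: sq_tens => //; apply/sq1/esym/dim3E.
rewrite addSn !siteS ?leq_addl // ?(leq_trans _ (leq_addl _ _)) // tensmx_mul mulmx1.
rewrite -(sq_tens IH erefl) [RHS]sq_tensA; apply: sq_tens => //.
by rewrite tens1mx1 -expnSr.
Qed.
End TaggedMatrix.

Definition letters n (xi : braid_word n) : seq (nat * bool) := [seq (val g.1, g.2) | g <- xi].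

Lemma letters_lt_letters n (xi : braid_word n) : letters_lt n (letters xi).
Proof.
rewrite /letters_lt all_map; apply/allP => -[i b] _ /=; have := ltn_ord i; lia.
Qed.

(** * The constants of the operator and its identification with a gate *)

Section GateOperator.
Variable R : realType.
Local Notation C := R[i].
Local Notation w := (omega R).
Local Notation s := (sqrtC (3 : C)).
Local Notation Z := (clock_Z R).
Local Notation X := (shift_X R).

Let theta : R := 2 * pi / 3.

Let sin_theta_gt0 : 0 < sin theta.
Proof. by apply: sin_gt0_pi; have := pi_gt0 R; rewrite /theta; lra. Qed.

Let sin_sqr : sin theta ^+ 2 = 1 - cos theta ^+ 2.
Proof. by rewrite -(cos2Dsin2 theta); ring. Qed.

(** With [c] the cosine, the triple-angle formula gives [4 c^3 - 3 c - 1 = (c - 1) (2 c + 1)^2 = 0],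
    and [c = 1] is excluded because the sine is positive. *)
Let cos_theta : cos theta = - 2^-1.
Proof.
have : cos (theta + theta + theta) = 1.
  by rewrite (_ : _ + _ = pi *+ 2) ?cos2pi // /theta; field.
rewrite !(cosD, sinD) => cos3.
have : (cos theta - 1) * (2 * cos theta + 1) ^+ 2 = 0.
  transitivity (4 * cos theta ^+ 3 - 3 * cos theta - 1); first by ring.
  rewrite -[X in _ - X]cos3.
  transitivity (3 * cos theta * (sin theta ^+ 2 - (1 - cos theta ^+ 2))); first by ring.
  by rewrite sin_sqr subrr mulr0.
move=> /eqP; rewrite mulf_eq0 expf_eq0 /= => /orP[/eqP c1|/eqP]; last by lra.
have := sin_sqr; rewrite (subr0_eq c1) expr1n subrr => /eqP.
by rewrite expf_eq0 /= gt_eqF.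
Qed.

Let sin_sqr34 : sin theta ^+ 2 = 3 / 4.
Proof. by rewrite sin_sqr cos_theta; field. Qed.

Lemma omega_root : 1 + w + w ^+ 2 = 0.
Proof.
apply/eqP; rewrite eq_complex /= -/theta; apply/andP; split; apply/eqP.
  by rewrite -!expr2 sin_sqr34 cos_theta; field.
by rewrite cos_theta; field.
Qed.

Lemma sqrt3E : s = (2 * sin theta)%:C.
Proof.
rewrite -[RHS]sqrCK; last by rewrite lecR mulr_ge0 // ltW.
congr sqrtC; rewrite -rmorphXn exprMn sin_sqr34 /=.
by rewrite (_ : 2 ^+ 2 * (3 / 4) = 3%:R :> R) ?rmorph_nat //; field.
Qed.

(** As [w^2] is the conjugate of [w], the difference is [2 i] times the sine; this is what fixes the
    skein variable [z] to be [i]. *)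
Lemma i_sqrt3 : 'i * s = w - w ^+ 2.
Proof.
rewrite sqrt3E; apply/eqP; rewrite eq_complex /= -/theta; apply/andP; split; apply/eqP.
  have := sin_sqr34; rewrite expr2 cos_theta => ss; lra.
by rewrite cos_theta; field.
Qed.

Lemma omega_neq1 : w != 1.
Proof. by rewrite eq_complex /= -/theta cos_theta negb_and; apply/orP; left; apply/eqP; lra. Qed.

Lemma omega_neq0 : w != 0.
Proof. by rewrite eq_complex /= -/theta cos_theta negb_and; apply/orP; left; apply/eqP; lra. Qed.

Lemma sqrt3_neq0 : s != 0. Proof. by rewrite sqrtC_eq0 pnatr_eq0. Qed.

Let omega_cube : w ^+ 3 = 1.
Proof. exact: cube_root_unity omega_root. Qed.

Lemma clock_cube : Z *m Z *m Z = 1%:M.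
Proof.
apply/matrixP => i j; do 2!rewrite !mxE !big_ord_recr !big_ord0 /=.
rewrite !mxE; case: i j => [[|[|[|]]] ?] // [[|[|[|]]] ?] //=; rewrite ?eqE /= ?eqE /=.
all: rewrite ?(mulr0n, mulr1n, mulr0, mulr1, mul0r, mul1r, addr0, add0r, expr0, expr1) //.
  by rewrite -expr2 -exprSr omega_cube.
by rewrite -!exprD (exprM _ 3 2) omega_cube expr1n.
Qed.

Lemma shift_cube : X *m X *m X = 1%:M.
Proof.
apply/matrixP => i j; do 2!rewrite !mxE !big_ord_recr !big_ord0 /=.
rewrite !mxE; case: i j => [[|[|[|]]] ?] // [[|[|[|]]] ?] //=; rewrite ?eqE /= ?eqE /=.
all: by rewrite ?(mulr0, mulr1, mul0r, addr0, add0r).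
Qed.

Lemma clock_shift : Z *m X = w *: (X *m Z).
Proof.
apply/matrixP => i j; rewrite !mxE !big_ord_recr !big_ord0 /= !mxE.
case: i j => [[|[|[|]]] ?] // [[|[|[|]]] ?] //=; rewrite ?eqE /= ?eqE /=.
all: by rewrite ?(mulr0n, mulr1n, mulr0, mulr1, mul0r, mul1r, addr0, add0r, expr0, expr1).
Qed.

Lemma tens_clock_unit : (Z *t Z) *m ((Z *m Z) *t (Z *m Z)) = 1%:M.
Proof. by rewrite tensmx_mul mulmxA clock_cube tens1mx1. Qed.

(** Conjugation by [Z (x) Z] fixes the factor [Z] of [U] and multiplies the factor [X] by [w]. *)
Lemma R1_gate : R1 R = gate w s (Z *t X).
Proof.
rewrite /R1 (invmx_eq tens_clock_unit) /op_U.
apply: (@gate_conj _ w s omega_root _ (Z *t X) (Z *t Z) _ tens_clock_unit).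
by rewrite !tensmx_mul clock_shift; apply/matrixP => i j; rewrite !mxE mulrCA.
Qed.

Lemma gate_tens m n (U : 'M[C]_n) :
  gate w s ((1%:M : 'M_m) *t U) = (1%:M : 'M_m) *t gate w s U.
Proof.
rewrite /gate /gate_sum tensmx_mul mulmx1 -tens1mx1.
by apply/matrixP => i j; rewrite !mxE; ring.
Qed.

Lemma sq_rho_gen n (i : 'I_n.-1) : sq (rho_gen R i) = sq (gate w s (site_U Z X n i)).
Proof.
rewrite /rho_gen sq_cast R1_gate -gate_tens -tens_gate.
(* The number of strands is rewritten in the shape used by [sq_site]. *)
have eq_n : n = (n - i - 2 + i.+2)%N by have := ltn_ord i; clear; lia.
have -> : sq (gate w s (site_U Z X n i)) =
    sq (gate w s (site_U Z X (n - i - 2 + i.+2) i)) by rewrite -eq_n.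
exact: (sq_transport (sq_site i (n - i - 2) Z X)
  (P := fun k M => sq (gate w s _) = sq (gate w s M))).
Qed.

Lemma sq_rho n (xi : braid_word n) : sq (rho R xi) = sq (word_mx w Z X s n (letters xi)).
Proof.
elim: xi => [|[i b] xi IH]; first by rewrite /rho /word_mx !big_nil; apply/sq1/esym/dim3E.
rewrite /rho big_cons -/(rho R xi) word_mx_cons; apply: sq_mul => //=.
case: b; first exact: sq_rho_gen.
(* An inverse letter contributes [invmx] on one side and [gateV] on the other. *)
rewrite -(invmx_eq (gateK omega_root (sqrtCK _) sqrt3_neq0
  (site_U_cube clock_cube shift_cube n i))).
exact: (sq_transport (sq_rho_gen i) (P := fun k M => sq (invmx (rho_gen R i)) = sq (invmx M))).
Qed.

Lemma P1_word_value n (xi : braid_word n) :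
  P1 R xi = word_value w Z X s n (letters xi).
Proof.
rewrite /P1 /T1 /word_value; do 2!congr (_ * _).
exact: (sq_transport (sq_rho xi) (P := fun k M => \tr (rho R xi) = \tr M)).
Qed.
End GateOperator.

Theorem theorem12p4 (R : realType) (PH : link_diagram -> laurent)
    (PH_HOMFLYPT : is_HOMFLYPT R PH)
    (L : link_diagram) (n : nat) (n_gt0 : (0 < n)%N) (xi : braid_word n)
    (L_closure : isotopic L (braid_closure xi)) :
  P1 R xi = laurent_eval (PH L) (omega R) ('i : R[i]).
Proof.
have [PH_iso PH_unknot _] := PH_HOMFLYPT.
have i_neq0 : ('i : R[i]) != 0 by rewrite eq_complex /= oner_eq0 andbF.
pose value D := laurent_eval (PH D) (omega R) ('i : R[i]).
have closureE m (x : braid_word m) :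
    diagram_value 0 value (closure_diagram m (letters x)) = value (braid_closure x).
  rewrite -(diagram_value_val 0); congr diagram_value.
  by rewrite /= /closure_slices /closure_diagram /crossings -map_comp.
(* The difference of the matrix side and the HOMFLYPT side at [a = omega], [z = i]. *)
have skein := skein_functionalB
  (word_value_skein_functional (clock_cube R) (shift_cube R) (clock_shift R) (omega_root R)
     (sqrtCK _) (sqrt3_neq0 R) (omega_neq1 R) (i_sqrt3 R))
  (HOMFLYPT_skein_functional PH_HOMFLYPT (omega_neq0 R) i_neq0).
rewrite (PH_iso _ _ L_closure) -/(value _) -closureE P1_word_value.
case: n n_gt0 xi {L_closure} => // n _ xi; apply/subr0_eq.
refine (skein_functional_eq0 (omega_neq0 R) i_neq0 skein _ (letters_lt_letters xi)).
(* On the trivial one-strand braid both sides are 1, its closure being the diagram [unknot]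
   itself. *)
rewrite word_value_unknot ?sqrtCK ?sqrt3_neq0 //.
rewrite -[closure_diagram 1 [::]]/(val unknot) diagram_value_val PH_unknot ?subrr //.
exact: omega_neq0.
Qed.
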